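(* Let $\mathbb{T} = \{ T_n = \tfrac{n(n+1)}{2} : n \ge 1\}$ be the set of positive triangular numbers. If $f$ is a multiplicative function satisfying \[ f(a+b+c+d) = f(a)+f(b)+f(c)+f(d) \] for all $a,b,c,d \in \mathbb{T}$, then $f$ is the identity function, i.e. $f(n)=n$ for all positive integers $n$.
   Context: A multiplicative function is a complex-valued function $f$ on the positive integers, not identically zero, with $f(mn)=f(m)f(n)$ whenever $\gcd(m,n)=1$. *)

(* Defs.v *)
From HB Require Import structures.
From mathcomp Require Import all_boot all_order all_algebra.
From mathcomp Require Import reals.
From mathcomp Require Import complex.

Set Implicit Arguments.
Unset Strict Implicit.
Unset Printing Implicit Defensive.

Import Order.TTheory GRing.Theory Num.Theory.

Local Open Scope ring_scope.

(* A function on the positive integers is encoded as a function on nat whose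
   value at 0 is junk: every condition below is restricted to positive
   arguments. *)
Definition multiplicative_function (R : realType) (f : nat -> R[i]) : Prop :=
  (exists n : nat, (0 < n)%N /\ f n <> 0) /\
  (forall m n : nat, (0 < m)%N -> (0 < n)%N -> coprime m n ->
     f (m * n)%N = f m * f n).

(* The division by 2 is exact, since n * (n + 1) is even. *)
Definition triangular_number (n : nat) : nat := ((n * (n + 1)) %/ 2)%N.

Definition positive_triangular (a : nat) : Prop :=
  exists n : nat, (1 <= n)%N /\ a = triangular_number n.

(* Main.v *)
(* For n >= 4, T_n + T_(n-3) + 1 = T_(n-1) + T_(n-2) + 3, so the additivity
   hypothesis makes f(T_n) satisfy a linear recurrence determined by f(2) and
   f(3).  Evaluating f at 6, 9, 10, 15 and 18 in two ways gives f(2) = 2 and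
   f(3) = 3, hence f(T_n) = T_n for all n.  The values f(n) then follow by
   strong induction: (2h+1)(h+1) = T_(2h+1) settles odd arguments,
   2h(h+1) = 4 T_h settles 2h for even h, and f(2h) = f(2) f(h) for odd h. *)
Require Import Defs.
From HB Require Import structures.
From mathcomp Require Import all_boot all_order all_algebra.
From mathcomp Require Import reals.
From mathcomp Require Import complex.
From mathcomp Require Import ring zify.

Set Implicit Arguments.
Unset Strict Implicit.
Unset Printing Implicit Defensive.

Import Order.TTheory GRing.Theory Num.Theory.

Local Open Scope ring_scope.

Lemma triangular_numberE n : (2 * triangular_number n = n * (n + 1))%N.
Proof.
rewrite /triangular_number mulnC divnK // dvdn2 oddM oddD.
by case: (odd n).
Qed.

Lemma positive_triangularT n :
  (0 < n)%N -> positive_triangular (triangular_number n).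
Proof. by exists n. Qed.

Lemma multiplicative_function1 (R : realType) (f : nat -> R[i]) :
  multiplicative_function f -> f 1%N = 1.
Proof.
move=> [[n [n_gt0 /eqP fn_neq0]] fM].
apply: (mulfI fn_neq0).
by rewrite -fM ?coprimen1 // muln1 mulr1.
Qed.

(* The quadratic for f(2) also has the root -1/2, which forces f(3) = -2 and
   f(5) = 10; this is excluded by f(15). *)
Lemma values_at_2_and_3 (F : numFieldType) (x y z : F) :
  x * y = y + 3 -> x * (y + 6) = 4 * y + 6 ->
  x * z = 3 * y + 1 -> y * z = 4 * y + 3 -> x = 2 /\ y = 3.
Proof.
move=> e6 e18 e10 e15.
have three_neq0 : 3 != 0 :> F by rewrite pnatr_eq0.
(* The product [x * y] cancels in [e6 - e18], which leaves a linear relation. *)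
have ey : y = 2 * x - 1.
  apply: (mulfI three_neq0); apply/subr0_eq.
  have -> : 3 * y - 3 * (2 * x - 1) =
            (x * y - (y + 3)) - (x * (y + 6) - (4 * y + 6)) by ring.
  by rewrite e6 e18; ring.
have /eqP : (x - 2) * (2 * x + 1) = 0.
  have -> : (x - 2) * (2 * x + 1) = x * (2 * x - 1) - (2 * x - 1 + 3) by ring.
  by rewrite -ey e6 subrr.
rewrite mulf_eq0 => /orP[/eqP/subr0_eq x2|/eqP x_neg].
  by split=> //; rewrite ey x2; ring.
have yN2 : y = - 2.
  have -> : y = (2 * x + 1) - 2 by rewrite ey; ring.
  by rewrite x_neg; ring.
move: e10 e15; rewrite yN2 => e10 e15.
(* Since [2 * x + 1 = 0], the combination of [e10] and [e15] below eliminates [z]. *)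
have : 15 = 0 :> F.
  have -> : 15 = 4 * (x * z - (3 * (- 2) + 1)) - 2 * z * (2 * x + 1)
                 - (- 2 * z - (4 * (- 2) + 3)) :> F by ring.
  by rewrite e10 e15 x_neg; ring.
by move/eqP; rewrite pnatr_eq0.
Qed.

(** The value at 2, which is not triangular, is kept for doubling odd numbers later. *)
Lemma additive_on_triangular (R : realType) (f : nat -> R[i]) :
  multiplicative_function f ->
  (forall a b c d : nat,
     positive_triangular a -> positive_triangular b ->
     positive_triangular c -> positive_triangular d ->
     f (a + b + c + d)%N = f a + f b + f c + f d) ->
  f 2 = 2 /\
  forall n, (0 < n)%N -> f (triangular_number n) = (triangular_number n)%:R.
Proof.
move=> hmul hadd.
have f1 := multiplicative_function1 hmul; have [_ fM] := hmul.
have p1 : positive_triangular 1 by exact: (@positive_triangularT 1).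
have p3 : positive_triangular 3 by exact: (@positive_triangularT 2).
have p6 : positive_triangular 6 by exact: (@positive_triangularT 3).
have recT n : (0 < n)%N ->
    f (triangular_number n.+3) = f (triangular_number n.+2)
      + f (triangular_number n.+1) - f (triangular_number n) + f 3 - 1.
  move=> n_gt0.
  (* The extra 1 gives each side exactly four triangular terms, so [hadd] applies to both. *)
  have eT : (triangular_number n.+3 + triangular_number n + 1 + 1 =
             triangular_number n.+2 + triangular_number n.+1 + 3 + 1)%N.
    have := (triangular_numberE n, triangular_numberE n.+1,
             triangular_numberE n.+2, triangular_numberE n.+3).
    by case=> [[[]]]; nia.
  have := congr1 f eT.
  rewrite !hadd //; try exact: positive_triangularT.
  rewrite !f1 => e.
  have -> : f (triangular_number n.+3) =
    f (triangular_number n.+3) + f (triangular_number n) + 1 + 1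
    - f (triangular_number n) - 2 by ring.
  by rewrite e; ring.
have e6 : f 2 * f 3 = f 3 + 3.
  by rewrite -fM // (hadd 1 1 1 3)%N // !f1; ring.
have e9 : f 9 = f 3 + 6.
  by rewrite (hadd 1 1 1 6)%N // !f1 (fM 2 3)%N // e6; ring.
have e18 : f 2 * (f 3 + 6) = 4 * f 3 + 6.
  by rewrite -e9 -fM // (hadd 6 6 3 3)%N // (fM 2 3)%N // e6; ring.
have e10 : f 2 * f 5 = 3 * f 3 + 1.
  by rewrite -fM // (hadd 3 3 3 1)%N // f1; ring.
(* 15 is [T_5], reached by the recurrence from [T_4 = 2 * 5], [T_3 = 2 * 3] and [T_2 = 3]. *)
have e15 : f 3 * f 5 = 4 * f 3 + 3.
  rewrite -fM // (recT 2) //.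
  rewrite -[triangular_number 4]/(2 * 5)%N -[triangular_number 3]/(2 * 3)%N.
  by rewrite -[triangular_number 2]/3%N !fM // e10 e6; ring.
have [f2 f3] := values_at_2_and_3 e6 e18 e10 e15.
(* The recurrence first yields [T_4], so [T_1], [T_2] and [T_3] are base cases. *)
split=> // n; elim/ltn_ind: n => -[|[|[|[|n]]]] IHn // _.
- by rewrite -[triangular_number 3]/(2 * 3)%N fM // f2 f3 -natrM.
rewrite recT // f3 !IHn //; last by lia.
have eT : (triangular_number n.+4 + triangular_number n.+1 + 1 =
           triangular_number n.+3 + triangular_number n.+2 + 3)%N.
  have := (triangular_numberE n.+1, triangular_numberE n.+2,
           triangular_numberE n.+3, triangular_numberE n.+4).
  by case=> [[[]]]; nia.
have := congr1 (fun k => k%:R : R[i]) eT; rewrite !natrD => e.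
apply: (addIr (triangular_number n.+1)%:R); apply: (addIr 1).
by rewrite e; ring.
Qed.

Theorem theorem3p1 (R : realType) (f : nat -> R[i])
  (hmul : multiplicative_function f)
  (hadd : forall a b c d : nat,
     positive_triangular a -> positive_triangular b ->
     positive_triangular c -> positive_triangular d ->
     f (a + b + c + d)%N = f a + f b + f c + f d) :
  forall n : nat, (0 < n)%N -> f n = n%:R.
Proof.
have [_ fM] := hmul.
have [f2 fT] := additive_on_triangular hmul hadd.
elim/ltn_ind => n IHn n_gt0.
have [n_odd|n_even] := boolP (odd n).
  have [h nE] : exists h, n = h.*2.+1.
    by exists n./2; rewrite -[LHS]odd_double_half n_odd.
  (* The cofactor [(n + 1) / 2] of [n] in [T_n] is below [n] only for [n > 1], so 1 is treated
     apart. *)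
  case: h nE => [|h] nE; first by rewrite nE (multiplicative_function1 hmul).
  have h_neq0 : h.+2%:R != 0 :> R[i] by rewrite pnatr_eq0.
  have eT : triangular_number n = (n * h.+2)%N.
    by have := triangular_numberE n; nia.
  have cop : coprime n h.+2.
    have -> : n = (h.+1 + h.+2)%N by lia.
    by rewrite -coprime_modl modnDr coprime_modl coprimenS.
  apply: (mulIf h_neq0).
  rewrite -{1}IHn //; last by lia.
  by rewrite -fM // -eT fT // eT natrM.
have [h nE] : exists h, n = (2 * h)%N.
  by exists n./2; rewrite mul2n even_halfK.
have h_gt0 : (0 < h)%N by lia.
have [h_odd|h_even] := boolP (odd h).
  rewrite nE fM ?coprime2n // f2 IHn ?natrM //; by lia.
have h1_neq0 : h.+1%:R != 0 :> R[i] by rewrite pnatr_eq0.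
(* Evenness of [h] makes [h.+1] odd, hence coprime to the factor 2 of [n] as well as to [h]. *)
have cop : coprime n h.+1 by rewrite nE coprimeMl coprime2n /= h_even coprimenS.
have eT : (triangular_number h + triangular_number h + triangular_number h
           + triangular_number h = n * h.+1)%N.
  by have := triangular_numberE h; nia.
apply: (mulIf h1_neq0).
(* Induction at [h.+1] needs [h.+1 < 2 * h]; the only bad positive value, [h = 1], is odd. *)
rewrite -{1}IHn //; last by case: h nE h_gt0 h_even {h1_neq0 cop eT} => [|[|h]] //; lia.
have ph := positive_triangularT h_gt0.
by rewrite -fM // -eT hadd // !fT // -!natrD eT natrM.
Qed.
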